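(* Let $A\in\mathbb{C}^{n\times n}$ have no eigenvalues on the closed negative real axis $(-\infty,0]$, let $\alpha\in(0,1)$, and let $\|\cdot\|$ be a consistent matrix norm. For a given interval $[l,r]$, let $a=\exp(\alpha\pi\sinh(l)/2)$ and $b=\exp(\alpha\pi\sinh(r)/2)$. If $a\le (2\|A^{-1}\|)^{-\alpha}$ and $b\ge (2\|A\|)^{\alpha}$, then $$\left\|\int_{-\infty}^{\infty} F_{\mathrm{DE}}(x)\,\mathrm{d}x-\int_l^r F_{\mathrm{DE}}(x)\,\mathrm{d}x\right\|\le \frac{\sin(\alpha\pi)\,[\alpha+(1+\alpha)\|I\|]}{\alpha\pi(1+\alpha)}\,a+\frac{\sin(\alpha\pi)(3-2\alpha)\|A\|}{\pi(1-\alpha)(2-\alpha)}\,b^{1-1/\alpha}.$$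
   Context: $I$ is the $n\times n$ identity matrix. A consistent matrix norm is a norm on $\mathbb{C}^{n\times n}$ that is submultiplicative, $\|XY\|\le\|X\|\,\|Y\|$ (e.g. the operator $p$-norms and the Frobenius norm); $\|I\|$ need not equal $1$. For $A$ and $\alpha$, define for $t\in(0,\infty)$ $$F(t)=\frac{\sin(\alpha\pi)}{\alpha\pi}\,A\,(t^{1/\alpha}I+A)^{-1},$$ and for $x\in\mathbb{R}$ $$t(x)=\exp(\alpha\pi\sinh(x)/2),\qquad F_{\mathrm{DE}}(x)=t'(x)\,F(t(x)).$$ Integrals of matrix-valued functions are taken entrywise. (The integral $\int_{-\infty}^{\infty}F_{\mathrm{DE}}(x)\,\mathrm{d}x=\int_0^\infty F(t)\,\mathrm{d}t$ equals the principal matrix power $A^\alpha=\exp(\alpha\log A)$.) The interval $[l,r]$ is a finite real interval. *)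

(* Defs.v *)
From HB Require Import structures.
From mathcomp Require Import all_boot all_order all_algebra.
From mathcomp Require Import complex.
From mathcomp Require Import all_classical all_reals all_analysis.

Set Implicit Arguments.
Unset Strict Implicit.
Unset Printing Implicit Defensive.

Import Order.TTheory GRing.Theory Num.Theory.
Import numFieldNormedType.Exports.

Local Open Scope classical_set_scope.
Local Open Scope ring_scope.
Local Open Scope complex_scope.

(* [Re `|c|] is the modulus of [c] as an element of [R]: the library norm on
   [R[i]] takes its values in [R[i]]. *)
Record consistent_norm (R : realType) (n : nat) (N : 'M[R[i]]_n -> R) : Prop :=
  ConsistentNorm {
    consistent_norm_ge0 : forall X, 0 <= N X ;
    consistent_norm_eq0 : forall X, N X = 0 -> X = 0 ;
    consistent_normZ : forall c X, N (c *: X) = complex.Re `|c| * N X ;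
    consistent_normD : forall X Y, N (X + Y) <= N X + N Y ;
    consistent_normM : forall X Y, N (X *m Y) <= N X * N Y
  }.

(* Entrywise Lebesgue integral; a complex entry is integrated through its real
   and imaginary parts. *)
Definition mxintegral (R : realType) (n : nat) (D : set R)
    (G : R -> 'M[R[i]]_n) : 'M[R[i]]_n :=
  \matrix_(i, j)
    ((\int[@lebesgue_measure R]_(x in D) complex.Re (G x i j)) +i*
     (\int[@lebesgue_measure R]_(x in D) complex.Im (G x i j)))%R.

Definition sinh (R : realType) (x : R) : R := (expR x - expR (- x)) / 2.

Definition F (R : realType) (n : nat) (A : 'M[R[i]]_n) (alpha t : R) :
    'M[R[i]]_n :=
  (sin (alpha * pi) / (alpha * pi))%:C *:
    (A *m invmx ((t `^ (1 / alpha))%:C%:M + A)).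

Definition t_DE (R : realType) (alpha x : R) : R :=
  expR (alpha * pi * sinh x / 2).

Definition F_DE (R : realType) (n : nat) (A : 'M[R[i]]_n) (alpha x : R) :
    'M[R[i]]_n :=
  (derive1 (t_DE alpha) x : R)%:C *: F A alpha (t_DE alpha x).

(* Main.v *)
Require Import Defs.
From HB Require Import structures.
From mathcomp Require Import all_boot all_order all_algebra.
From mathcomp Require Import complex.
From mathcomp Require Import all_classical all_reals all_analysis.
From mathcomp Require Import measurable_realfun ring lra.

(** Write [s = t(x)^(1/alpha)]. The error is the sum of the integrals of [F_DE]
over the two tails [x <= l] and [x >= r], so everything reduces to bounding
[N (A (s I + A)^-1)] when [s] is small (left tail) or large (right tail).

On the left, [A (s I + A)^-1 = I - s (s I + A)^-1] and
[(s I + A)^-1 = A^-1 - s (s I + A)^-1 A^-1]. When [2 s N(A^-1) <= 1] the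
second identity gives [N((s I + A)^-1) <= 2 N(A^-1)], hence the bound
[N(I) + 2 s N(A^-1)] ([norm_mul_shift_inv_small]). On the right,
[X = A (s I + A)^-1] satisfies [X = s^-1 (A - A X)]; when [2 N(A) <= s] this
gives [N(X) <= 2 N(A)/s], and once more
[N(X) <= N(A)/s + 2 (N(A)/s)^2] ([norm_mul_shift_inv_large]). The hypotheses on
[a] and [b] put the whole of each tail in the corresponding regime.

Since [t(x)^p] is an exponential [exp(c sinh x)], [t'(x)] times each bound is a
combination of derivatives of such exponentials, so the fundamental theorem of
calculus integrates it in closed form without any change of variables.

That the norm of an entrywise integral is at most the integral of the norm
([norm_mxintegral_le]) comes from a finite-dimensional Hahn-Banach argument:
a sublinear functional [p] has at each point a supporting linear form below
[p] ([sublinear_support]), and linear forms commute with the integral.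
Integrability of the entries is also obtained from the majorants, because
[E_ii X E_jj = X_ij E_ij] and submultiplicativity bound every entry of [X] by a
multiple of [N X]. *)

Import Order.TTheory GRing.Theory Num.Theory.
Import numFieldNormedType.Exports.

Local Open Scope classical_set_scope.
Local Open Scope ring_scope.
Local Open Scope complex_scope.

Set Implicit Arguments.
Unset Strict Implicit.
Unset Printing Implicit Defensive.

(** * Supporting linear forms of sublinear functionals *)

Definition sublinear (R : realType) (V : lmodType R) (p : V -> R) : Prop :=
  (forall x y, p (x + y) <= p x + p y) /\
  (forall c x, 0 <= c -> p (c *: x) = c * p x).

Lemma sublinear0 (R : realType) (V : lmodType R) (p : V -> R) :
  sublinear p -> p 0 = 0.
Proof. by case=> _ pZ; rewrite -(scale0r (0 : V)) pZ ?mul0r. Qed.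

Lemma sublinear_oppr_ge (R : realType) (V : lmodType R) (p : V -> R) x :
  sublinear p -> - p (- x) <= p x.
Proof.
move=> sp; case: (sp) => pD _.
by have := pD x (- x); rewrite subrr (sublinear0 sp); lra.
Qed.

(** The functional [q x = inf_(t >= 0) (p (x + t v) - t p v)] is the largest
sublinear functional below [p] whose value at [- v] is at most [- p v]. With
[q <= p] and [0 <= q v + q (- v)] that bound forces [q v = p v = - q (- v)]: [q]
is linear on the line of [v] and keeps the value at [v]. *)
Lemma sublinear_odd_direction (R : realType) (V : lmodType R) (p : V -> R)
    (v : V) : sublinear p ->
  exists q : V -> R, [/\ sublinear q, forall x, q x <= p x & q (- v) <= - p v].
Proof.
move=> sp; case: (sp) => pD pZ.
pose E x : set R := [set p (x + t *: v) - t * p v | t in [set t | 0 <= t]].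
have E0 x : E x !=set0 by exists (p (x + 0 *: v) - 0 * p v); exists 0 => //=.
have lbE x : lbound (E x) (- p (- x)).
  move=> _ [t /= t0 <-]; rewrite -pZ //.
  by have := pD (- x) (x + t *: v); rewrite addKr; lra.
have qE x t : 0 <= t -> inf (E x) <= p (x + t *: v) - t * p v.
  by move=> t0; apply: ge_inf; [exists (- p (- x)); exact: lbE | exists t].
have le_infE x m : (forall t, 0 <= t -> m <= p (x + t *: v) - t * p v) ->
    m <= inf (E x).
  by move=> le_m; apply: lb_le_inf => // _ [t /= t0 <-]; exact: le_m.
have qp x : inf (E x) <= p x.
  by have := qE x 0 (lexx 0); rewrite scale0r addr0 mul0r subr0.
have qcle c x : 0 < c -> inf (E (c *: x)) <= c * inf (E x).
  move=> c0; rewrite -ler_pdivrMl //; apply: (le_infE) => t t0.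
  rewrite ler_pdivrMl // mulrBr -(pZ c) ?(ltW c0) // scalerDr scalerA mulrA.
  by apply: qE; rewrite mulr_ge0 // ltW.
exists (fun x => inf (E x)); split => //; first split.
- move=> x y /=; rewrite -lerBlDr; apply: (le_infE) => t t0.
  rewrite lerBlDr [leRHS]addrC -lerBlDr; apply: (le_infE) => s s0.
  rewrite lerBlDr; apply: le_trans (qE _ (t + s) (addr_ge0 t0 s0)) _.
  have := pD (x + t *: v) (y + s *: v).
  by rewrite addrACA -scalerDl mulrDl; lra.
- move=> c x /=; rewrite le_eqVlt => /predU1P[<-|c0].
    rewrite scale0r mul0r; apply/eqP; rewrite eq_le.
    have := qp 0; have := lb_le_inf (E0 0) (lbE 0).
    by rewrite oppr0 (sublinear0 sp) oppr0 => -> ->.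
  apply/eqP; rewrite eq_le qcle //=.
  rewrite -ler_pdivlMl //; apply: le_trans (qcle _ _ _); rewrite ?invr_gt0 //.
  by rewrite scalerA mulVf ?scale1r // gt_eqF.
have := qE (- v) 1 ler01.
by rewrite scale1r addNr (sublinear0 sp) mul1r sub0r.
Qed.

(** Oddness in a direction survives passing to a smaller sublinear functional,
so the directions can be treated one after the other. *)
Lemma sublinear_odd_directions (R : realType) (V : lmodType R) (s : seq V)
    (p : V -> R) : sublinear p ->
  exists q : V -> R, [/\ sublinear q, forall x, q x <= p x &
    forall v, v \in s -> q (- v) = - q v].
Proof.
elim: s p => [|v s IHs] p sp; first by exists p.
have [q1 [sq1 q1p q1v]] := sublinear_odd_direction v sp.
have [q [sq qq1 qs]] := IHs _ sq1.
exists q; split => // [x|w]; first exact: le_trans (q1p x).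
rewrite inE => /predU1P[->|/qs //].
have := sublinear_oppr_ge v sq.
have := qq1 (- v); have := qq1 v; have := q1p v; have := q1v; lra.
Qed.

Lemma sublinear_oddZ (R : realType) (V : lmodType R) (q : V -> R) (v : V) :
  sublinear q -> q (- v) = - q v -> forall c, q (c *: v) = c * q v.
Proof.
move=> [_ qZ] qNv c; have [c0|c0] := leP 0 c; first exact: qZ.
by rewrite -[c *: v]opprK -scaleNr -scalerN qZ ?qNv ?mulrNN // oppr_ge0 ltW.
Qed.

Lemma sublinear_sum (R : realType) (V : lmodType R) (q : V -> R) (I : Type)
    (r : seq I) (P : pred I) (f : I -> V) : sublinear q ->
  q (\sum_(i <- r | P i) f i) <= \sum_(i <- r | P i) q (f i).
Proof.
move=> sq; elim/big_rec2: _ => [|i y x _ le_xy]; first by rewrite sublinear0.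
by case: sq => qD _; apply: le_trans (qD _ _) _; rewrite lerD2l.
Qed.

(** After making [p] odd along [X0] and then along the elementary matrices, the
values at the elementary matrices are the coefficients of a linear form [f].
Expanding [X] in that basis yields [q X <= f X]; the same for [- X] gives the
equality. The step along [X0] pins the value [p X0]. *)
Lemma sublinear_support (R : realType) (m k : nat) (p : 'M[R]_(m, k) -> R)
    (X0 : 'M[R]_(m, k)) : sublinear p ->
  exists c : 'M[R]_(m, k),
    (forall X : 'M[R]_(m, k), \sum_i \sum_j c i j * X i j <= p X) /\
    p X0 <= \sum_i \sum_j c i j * X0 i j.
Proof.
move=> sp; have [q0 [sq0 q0p q0X0]] := sublinear_odd_direction X0 sp.
have [q [sq qq0 q_odd]] := sublinear_odd_directions
  [seq delta_mx ij.1 ij.2 | ij : 'I_m * 'I_k] sq0.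
pose c := \matrix_(i, j) q (delta_mx i j).
pose f (X : 'M[R]_(m, k)) := \sum_i \sum_j c i j * X i j.
have q_delta i j a : q (a *: delta_mx i j) = c i j * a.
  rewrite mxE mulrC; apply: sublinear_oddZ => //; apply: q_odd.
  by apply/mapP; exists (i, j) => //; rewrite mem_enum.
have qf X : q X <= f X.
  rewrite {1}(matrix_sum_delta X); apply: le_trans (sublinear_sum _ _ _ sq) _.
  apply: ler_sum => i _; apply: le_trans (sublinear_sum _ _ _ sq) _.
  by apply: ler_sum => j _; rewrite q_delta.
have fN X : f (- X) = - f X.
  rewrite /f -sumrN; apply: eq_bigr => i _.
  by rewrite -sumrN; apply: eq_bigr => j _; rewrite !mxE mulrN.
have fq X : f X <= q X.
  by have := qf (- X); have := sublinear_oppr_ge X sq; rewrite fN; lra.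
exists c; split => [X|]; rewrite -/(f _).
  by apply: le_trans (fq _) _; apply: le_trans (qq0 _) _.
have := qf X0; have := qq0 (- X0); have := sublinear_oppr_ge X0 sq.
by have := q0X0; lra.
Qed.

(** * Integrals and sublinear functionals *)

Lemma Rintegral_sum d (T : measurableType d) (R : realType)
    (mu : {measure set T -> \bar R}) (D : set T) (I : Type) (s : seq I)
    (f : I -> T -> R) : measurable D ->
  (forall i, mu.-integrable D (EFin \o f i)) ->
  (\int[mu]_(x in D) (\sum_(i <- s) f i x) =
   \sum_(i <- s) \int[mu]_(x in D) f i x)%R.
Proof.
move=> mD intf; rewrite /Rintegral.
under eq_integral do rewrite -sumEFin.
rewrite integral_sum // -sum_fine // => i _.
exact: (integrable_fin_num mD (intf i)).
Qed.

Lemma integrable_Rsum d (T : measurableType d) (R : realType)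
    (mu : {measure set T -> \bar R}) (D : set T) (I : Type) (s : seq I)
    (f : I -> T -> R) : measurable D ->
  (forall i, mu.-integrable D (EFin \o f i)) ->
  mu.-integrable D (EFin \o (fun x => \sum_(i <- s) f i x)).
Proof.
move=> mD intf.
rewrite (_ : _ \o _ = fun x => (\sum_(i <- s) (EFin \o f i) x)%E).
  exact: integrable_sum.
by apply/funext => x /=; rewrite sumEFin.
Qed.

Lemma integrable_RZl d (T : measurableType d) (R : realType)
    (mu : {measure set T -> \bar R}) (D : set T) (c : R) (f : T -> R) :
  measurable D -> mu.-integrable D (EFin \o f) ->
  mu.-integrable D (EFin \o (fun x => c * f x)).
Proof. by move=> mD intf; exact: (integrableZl mD c intf). Qed.

(** Jensen-type inequality: a supporting linear form at the integral commutes
with the integral. *)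
Lemma sublinear_integral_le d (T : measurableType d) (R : realType)
    (mu : {measure set T -> \bar R}) (D : set T) (m k : nat)
    (p : 'M[R]_(m, k) -> R) (G : T -> 'M[R]_(m, k)) (g : T -> R) :
  sublinear p -> measurable D ->
  (forall i j, mu.-integrable D (EFin \o (fun x => G x i j))) ->
  mu.-integrable D (EFin \o g) ->
  (forall x, D x -> p (G x) <= g x) ->
  p (\matrix_(i, j) (\int[mu]_(x in D) G x i j)%R) <= \int[mu]_(x in D) g x.
Proof.
move=> sp mD intG intg pGg.
set T0 := \matrix_(i, j) _.
have [c [cp cT0]] := sublinear_support T0 sp.
have intc i j : mu.-integrable D (EFin \o (fun x => c i j * G x i j)).
  exact: integrable_RZl.
have intr i : mu.-integrable D (EFin \o (fun x => \sum_j c i j * G x i j)).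
  exact: integrable_Rsum.
apply: le_trans cT0 _.
rewrite (_ : \sum_i _ = \int[mu]_(x in D) (\sum_i \sum_j c i j * G x i j))%R.
  apply: le_Rintegral => //; first exact: integrable_Rsum.
  by move=> x Dx; apply: le_trans (cp _) _; exact: pGg.
rewrite Rintegral_sum //; apply: eq_bigr => i _.
rewrite Rintegral_sum //; apply: eq_bigr => j _.
by rewrite mxE RintegralZl.
Qed.

(** * Consistent norms and the resolvent *)

Section ConsistentNorm.
Variables (R : realType) (n : nat) (N : 'M[R[i]]_n -> R).
Hypothesis hN : consistent_norm N.

Lemma Re_norm_real (c : R) : complex.Re `|c%:C| = `|c|.
Proof. by rewrite normc_def /= expr0n addr0 sqrtr_sqr. Qed.

Lemma consistent_normZ_real (c : R) X : N (c%:C *: X) = `|c| * N X.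
Proof. by rewrite (consistent_normZ hN) Re_norm_real. Qed.

Lemma consistent_normN X : N (- X) = N X.
Proof.
have -> : - X = (-1 : R)%:C *: X by rewrite rmorphN rmorph1 scaleN1r.
by rewrite consistent_normZ_real normrN1 mul1r.
Qed.

Lemma consistent_normB X Y : N (X - Y) <= N X + N Y.
Proof. by rewrite -(consistent_normN Y); exact: consistent_normD. Qed.

Lemma consistent_norm_gt0 X : X != 0 -> 0 < N X.
Proof.
move=> X0; rewrite lt_neqAle (consistent_norm_ge0 hN) andbT eq_sym.
by apply: contra_neq X0 => /(consistent_norm_eq0 hN).
Qed.

(** Multiplying by elementary matrices on both sides isolates one entry:
[E_ii X E_jj = X_ij E_ij]. *)
Lemma entry_le_consistent_norm (i j : 'I_n) :
  exists2 C : R, 0 <= C & forall X : 'M[R[i]]_n, complex.Re `|X i j| <= C * N X.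
Proof.
have E0 : 0 < N (delta_mx i j).
  apply: consistent_norm_gt0; apply/eqP => /matrixP/(_ i j)/eqP.
  by rewrite !mxE !eqxx oner_eq0.
exists (N (delta_mx i i) * N (delta_mx j j) / N (delta_mx i j)).
  by rewrite !mulr_ge0 ?invr_ge0 ?(consistent_norm_ge0 hN).
move=> X.
have eX : delta_mx i i *m X *m delta_mx j j = X i j *: delta_mx i j.
  apply/matrixP => k l; rewrite !mxE (bigD1 j) //= big1 ?addr0; last first.
    by move=> a aj; rewrite !mxE (negPf aj) /= mulr0.
  rewrite !mxE (bigD1 i) //= big1 ?addr0; last first.
    by move=> a ai; rewrite !mxE (negPf ai) andbF mul0r.
  rewrite !mxE !eqxx andbT /=.
  by case: (k == i); case: (l == j); rewrite ?mul1r ?mul0r ?mulr1 ?mulr0.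
rewrite mulrAC ler_pdivlMr // -(consistent_normZ hN) -eX mulrAC.
apply: le_trans (consistent_normM hN _ _) _.
by rewrite ler_wpM2r ?(consistent_norm_ge0 hN) ?(consistent_normM hN).
Qed.

Variable A : 'M[R[i]]_n.
Hypothesis hA : forall x : R, x <= 0 -> ~~ eigenvalue A x%:C.

Lemma shift_unitmx (s : R) : 0 <= s -> s%:C%:M + A \in unitmx.
Proof.
move=> s0; rewrite unitmxE unitfE; apply/negP => /det0P [v v0 vsA].
have /negP := hA (x := - s) ltac:(by rewrite oppr_le0); apply.
apply/eigenvalueP; exists v => //.
move: vsA; rewrite mulmxDr mul_mx_scalar => /eqP.
rewrite addrC addr_eq0 => /eqP ->.
by rewrite rmorphN scaleNr.
Qed.

(** The resolvent identity [B^-1 = A^-1 - s B^-1 A^-1] for [B = s I + A] bounds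
[N (B^-1)] by [2 N (A^-1)]; a Neumann series would bring in the factor [N 1]. *)
Lemma norm_mul_shift_inv_small (s : R) : 0 <= s -> 2 * s * N (invmx A) <= 1 ->
  N (A *m invmx (s%:C%:M + A)) <= N 1%:M + 2 * s * N (invmx A).
Proof.
move=> s0 sA; have uB := shift_unitmx s0.
set B := s%:C%:M + A in uB *.
have uA : A \in unitmx by have := shift_unitmx (lexx 0); rewrite raddf0 add0r.
have N0 := consistent_norm_ge0 hN.
have invB : invmx B = invmx A - s%:C *: (invmx B *m invmx A).
  apply/eqP; rewrite eq_sym subr_eq; apply/eqP.
  transitivity (invmx B *m B *m invmx A); first by rewrite mulVmx ?mul1mx.
  rewrite -mulmxA {2}/B mulmxDl mulmxV // mul_scalar_mx mulmxDr mulmx1.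
  by rewrite -scalemxAr addrC.
have NinvB : N (invmx B) <= 2 * N (invmx A).
  have : N (invmx B) <= N (invmx A) + s * (N (invmx B) * N (invmx A)).
    rewrite {1}invB; apply: le_trans (consistent_normB _ _) _.
    rewrite lerD2l consistent_normZ_real ger0_norm // ler_wpM2l //.
    exact: consistent_normM.
  have := N0 (invmx B); have := N0 (invmx A).
  have : 0 <= N (invmx B) * (1 - 2 * s * N (invmx A)).
    by rewrite mulr_ge0 ?subr_ge0.
  lra.
have -> : A *m invmx B = 1%:M - s%:C *: invmx B.
  apply/eqP; rewrite eq_sym subr_eq -mul_scalar_mx -mulmxDl addrC -/B.
  by rewrite mulmxV.
apply: le_trans (consistent_normB _ _) _.
rewrite lerD2l consistent_normZ_real ger0_norm //.
have : 0 <= s * (2 * N (invmx A) - N (invmx B)) by rewrite mulr_ge0 ?subr_ge0.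
lra.
Qed.

(** The fixed-point identity [X = s^-1 (A - A X)] gives [y <= e (1 + y)] for
[y = N X] and [e = N A / s <= 1/2]. It is used twice: first for the crude bound
[y <= 2 e], then with that bound inserted on the right. *)
Lemma norm_mul_shift_inv_large (s : R) : 0 < s -> 2 * N A <= s ->
  N (A *m invmx (s%:C%:M + A)) <= N A / s + 2 * (N A / s) ^+ 2.
Proof.
move=> s0 As; have uB := shift_unitmx (ltW s0).
set B := s%:C%:M + A in uB *; set X := A *m invmx B.
have N0 := consistent_norm_ge0 hN.
have sC0 : s%:C != 0 by rewrite fmorph_eq0 gt_eqF.
have eX : X = (s^-1)%:C *: (A - A *m X).
  apply: (scalerI sC0); rewrite scalerA -rmorphM mulfV ?gt_eqF // scale1r.
  rewrite scalemxAr -{2}(mulmx1 A) -mulmxBr; congr (A *m _).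
  apply/eqP; rewrite eq_sym subr_eq -mul_scalar_mx -mulmxDl -/B.
  by rewrite mulmxV.
have leX : N X <= N A / s * (1 + N X).
  rewrite {1}eX consistent_normZ_real ger0_norm ?invr_ge0 ?(ltW s0) //.
  rewrite mulrAC ler_pdivlMr // mulrAC mulVf ?gt_eqF // mul1r.
  apply: le_trans (consistent_normB _ _) _.
  by rewrite mulrDr mulr1 lerD2l consistent_normM.
have e0 : 0 <= N A / s by rewrite divr_ge0 // ltW.
have e1 : 2 * (N A / s) <= 1 by rewrite mulrA ler_pdivrMr // mul1r.
move: (N A / s) (N X) (N0 X) leX e0 e1 => e y y0 ley e0 e1.
have : 0 <= y * (1 - 2 * e) by rewrite mulr_ge0 ?subr_ge0.
have y2e : y <= 2 * e by nra.
have : 0 <= e * (2 * e - y) by rewrite mulr_ge0 ?subr_ge0.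
lra.
Qed.

End ConsistentNorm.

(** * Continuity of resolvent entries along a real path *)

(** Continuity through the real and imaginary parts, the form in which entrywise
integrals consume it. *)
Definition complex_continuous (R : realType) (f : R -> R[i]) : Prop :=
  continuous (fun x => complex.Re (f x)) /\
  continuous (fun x => complex.Im (f x)).

Lemma complex_continuous_horner (R : realType) (p : {poly R[i]}) (s : R -> R) :
  continuous s -> complex_continuous (fun x => p.[(s x)%:C]).
Proof.
move=> cs; elim/poly_ind: p => [|p c [cRe cIm]].
  by under eq_fun do rewrite horner0; split => x; exact: cst_continuous.
under eq_fun do rewrite hornerMXaddC.
split.
  rewrite (_ : (fun x => _) =
      fun x => complex.Re p.[(s x)%:C] * s x + complex.Re c).
    move=> x; apply: cvgD; last exact: cvg_cst.
    by apply: cvgM; [exact: cRe | exact: cs].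
  by apply/funext => y; case: p.[_] c => [a b] [c d] /=; rewrite mulr0 subr0.
rewrite (_ : (fun x => _) =
      fun x => complex.Im p.[(s x)%:C] * s x + complex.Im c).
  move=> x; apply: cvgD; last exact: cvg_cst.
  by apply: cvgM; [exact: cIm | exact: cs].
by apply/funext => y; case: p.[_] c => [a b] [c d] /=; rewrite mulr0 add0r.
Qed.

Lemma complex_continuousM (R : realType) (f g : R -> R[i]) :
  complex_continuous f -> complex_continuous g ->
  complex_continuous (fun x => f x * g x).
Proof.
move=> [fRe fIm] [gRe gIm]; split.
  rewrite (_ : (fun x => _) = fun x => complex.Re (f x) * complex.Re (g x) -
      complex.Im (f x) * complex.Im (g x)).
    move=> x; apply: cvgB; apply: cvgM;
      [exact: fRe | exact: gRe | exact: fIm | exact: gIm].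
  by apply/funext => y; case: (f y) (g y) => [? ?] [? ?].
rewrite (_ : (fun x => _) = fun x => complex.Re (f x) * complex.Im (g x) +
    complex.Im (f x) * complex.Re (g x)).
  move=> x; apply: cvgD; apply: cvgM;
    [exact: fRe | exact: gIm | exact: fIm | exact: gRe].
by apply/funext => y; case: (f y) (g y) => [? ?] [? ?].
Qed.

Lemma complex_continuousV (R : realType) (f : R -> R[i]) :
  (forall x, f x != 0) -> complex_continuous f ->
  complex_continuous (fun x => (f x)^-1).
Proof.
move=> f0 [fRe fIm].
pose m x := complex.Re (f x) ^+ 2 + complex.Im (f x) ^+ 2.
have m0 x : m x != 0.
  apply: contraNneq (f0 x); rewrite /m => /eqP.
  rewrite paddr_eq0 ?sqr_ge0 // !sqrf_eq0 => /andP[/eqP re0 /eqP im0].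
  by apply/eqP; case: (f x) re0 im0 => ? ? /= -> ->.
have cm : continuous m.
  by move=> x; apply: cvgD; apply: cvgM; (exact: fRe || exact: fIm).
split.
  rewrite (_ : (fun x => _) = fun x => complex.Re (f x) / m x).
    move=> x; apply: cvgM; first exact: fRe.
    by apply: cvgV; [exact: m0 | exact: cm].
  by apply/funext => y; rewrite /m; case: (f y).
rewrite (_ : (fun x => _) = fun x => - (complex.Im (f x) / m x)).
  move=> x; apply: cvgN; apply: cvgM; first exact: fIm.
  by apply: cvgV; [exact: m0 | exact: cm].
by apply/funext => y; rewrite /m; case: (f y).
Qed.

Lemma complex_continuous_real (R : realType) (f : R -> R) :
  continuous f -> complex_continuous (fun x => (f x)%:C).
Proof. by move=> cf; split => // x; exact: cst_continuous. Qed.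

(** By the adjugate formula each entry is a quotient of two polynomials in [s],
both read off the characteristic matrix of [- A]. *)
Lemma complex_continuous_shift_inv (R : realType) (n : nat) (A : 'M[R[i]]_n)
    (s : R -> R) : continuous s -> (forall x, (s x)%:C%:M + A \in unitmx) ->
  forall i j, complex_continuous (fun x => (A *m invmx ((s x)%:C%:M + A)) i j).
Proof.
move=> cs uB i j.
pose P := (map_mx polyC A *m \adj (char_poly_mx (- A))) i j.
have charE z : map_mx (horner_eval z) (char_poly_mx (- A)) = z%:M + A.
  apply/matrixP => k l; rewrite !mxE /horner_eval.
  by rewrite hornerD hornerN hornerC opprK hornerMn hornerX.
have detE z : (char_poly (- A)).[z] = \det (z%:M + A).
  by rewrite -charE (det_map_mx (horner_eval z)).
have entryE x : (A *m invmx ((s x)%:C%:M + A)) i j =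
    P.[(s x)%:C] * ((char_poly (- A)).[(s x)%:C])^-1.
  rewrite detE /invmx uB -scalemxAr mxE mulrC; congr (_ * _).
  rewrite -charE -(map_mx_adj (horner_eval (s x)%:C)) /P !mxE horner_sum.
  by apply: eq_bigr => k _; rewrite hornerM !mxE hornerC.
under eq_fun do rewrite entryE.
apply: complex_continuousM; first exact: complex_continuous_horner.
apply: complex_continuousV; last exact: complex_continuous_horner.
by move=> x; rewrite detE -unitfE -unitmxE.
Qed.

(** * Exponentials of the hyperbolic sine *)

Definition cosh (R : realType) (x : R) : R := (expR x + expR (- x)) / 2.

Lemma cosh_gt0 (R : realType) (x : R) : 0 < cosh x.
Proof. by rewrite divr_gt0 // addr_gt0 // expR_gt0. Qed.

Lemma sinhN (R : realType) (x : R) : sinh (- x) = - sinh x.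
Proof. by rewrite /sinh opprK -mulNr opprB. Qed.

Lemma coshN (R : realType) (x : R) : cosh (- x) = cosh x.
Proof. by rewrite /cosh opprK addrC. Qed.

Lemma is_derive_sinh (R : realType) (x : R) : is_derive x 1 (@sinh R) (cosh x).
Proof.
have -> : @sinh R = (fun y : R => 2^-1 * (expR y - expR (- y))).
  by apply/funext => y; rewrite /sinh mulrC.
apply: is_derive_eq; rewrite /cosh /GRing.scale /=.
by rewrite mulrN1 opprK mulrC.
Qed.

Lemma continuous_sinh (R : realType) : continuous (@sinh R).
Proof.
move=> x; apply/differentiable_continuous/derivable1_diffP.
by case: (is_derive_sinh x).
Qed.

Lemma continuous_cosh (R : realType) : continuous (@cosh R).
Proof.
move=> x; apply: cvgMr_tmp; apply: cvgD; first exact: continuous_expR.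
apply: continuous_comp; [exact: opp_continuous | exact: continuous_expR].
Qed.

Lemma is_derive_expR_sinh (R : realType) (c x : R) :
  is_derive x 1 (fun y => expR (c * sinh y)) (c * cosh x * expR (c * sinh x)).
Proof.
have ? := is_derive_sinh x.
apply: is_derive_eq; rewrite /GRing.scale /=.
by rewrite mulrC.
Qed.

Lemma sinh_ge (R : realType) (x : R) : 0 <= x -> x / 2 <= sinh x.
Proof.
move=> x0; rewrite ler_pM2r ?invr_gt0 //.
have := expR_ge1Dx x; have : expR (- x) <= 1 by rewrite expR_le1; lra.
lra.
Qed.

Lemma cvg_expR_sinh (R : realType) (c : R) : 0 < c ->
  expR (- c * sinh x) @[x --> +oo] --> (0 : R).
Proof.
move=> c0.
have e : expR (- (x * (c / 2))) @[x --> +oo] --> (0 : R).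
  apply: (@cvg_comp _ _ _ (fun x : R => x * (c / 2)) (fun y => expR (- y))).
    by apply: gt0_cvgMly; [rewrite divr_gt0|exact: cvg_id].
  exact: cvgr_expR.
apply: (squeeze_cvgr _ (cvg_cst 0) e).
near=> x; rewrite expR_ge0 /= ler_expR.
have x0 : 0 <= x by near: x; exact: nbhs_pinfty_ge.
have := sinh_ge x0; rewrite -(ler_pM2l c0); lra.
Unshelve. all: by end_near. Qed.

Lemma continuous_expR_sinh (R : realType) (c : R) :
  continuous (fun x => expR (c * sinh x)).
Proof.
move=> x; apply: (@continuous_comp _ _ _ (fun x => c * sinh x) expR).
  by apply: cvgMl_tmp; exact: continuous_sinh.
exact: continuous_expR.
Qed.

Lemma deriv_expR_sinh_ge0 (R : realType) (c d x : R) :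
  0 < c -> 0 <= c * cosh x * expR (d * sinh x).
Proof.
by move=> c0; rewrite mulr_ge0 ?expR_ge0 // mulr_ge0 ?(ltW (cosh_gt0 _)) ?ltW.
Qed.

Lemma continuous_deriv_expR_sinh (R : realType) (c d : R) :
  continuous (fun x => c * cosh x * expR (d * sinh x)).
Proof.
move=> x; apply: cvgM; last exact: continuous_expR_sinh.
by apply: cvgMl_tmp; exact: continuous_cosh.
Qed.

Lemma integral_expR_sinh_y (R : realType) (c r : R) : 0 < c ->
  (\int[lebesgue_measure]_(x in `[r, +oo[)
    (c * cosh x * expR (- c * sinh x))%:E = (expR (- c * sinh r))%:E)%E.
Proof.
move=> c0; pose f (x : R) : R := - expR (- c * sinh x).
have df (x : R) : is_derive x 1 f (c * cosh x * expR (- c * sinh x)).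
  have ? := is_derive_expR_sinh (- c) x.
  by apply: is_derive_eq; rewrite !mulNr opprK.
rewrite (@ge0_continuous_FTC2y _ _ f r 0).
- by rewrite sub0e /f EFinN oppeK.
- by move=> x _; exact: deriv_expR_sinh_ge0.
- by apply: continuous_subspaceT => x; exact: continuous_deriv_expR_sinh.
- by rewrite -oppr0; apply: cvgN; exact: cvg_expR_sinh.
- by move=> x _; case: (df x).
- apply: cvg_at_right_filter; apply: cvgN; exact: continuous_expR_sinh.
- by move=> x _; rewrite derive1E; apply: derive_val.
Qed.

(** Reflection [x -> - x] of the integral over a right half-line. *)
Lemma integral_expR_sinh_Ny (R : realType) (c l : R) : 0 < c ->
  (\int[lebesgue_measure]_(x in `]-oo, l])
    (c * cosh x * expR (c * sinh x))%:E = (expR (c * sinh l))%:E)%E.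
Proof.
move=> c0; rewrite -[l in LHS]opprK ge0_integration_by_substitutionNy.
- rewrite (_ : c * sinh l = - c * sinh (- l)); last by rewrite sinhN mulrNN.
  rewrite -(integral_expR_sinh_y (- l) c0); apply: eq_integral => x _.
  rewrite fctE.
  by rewrite coshN sinhN mulrN mulNr.
- by apply: continuous_subspaceT => x; exact: continuous_deriv_expR_sinh.
- by move=> x _; exact: deriv_expR_sinh_ge0.
Qed.

Lemma integrable_ge0_continuous (R : realType) (f : R -> R) (D : set R)
    (v : R) : measurable D -> continuous f -> (forall x, 0 <= f x) ->
  (\int[lebesgue_measure]_(x in D) (f x)%:E = v%:E)%E ->
  lebesgue_measure.-integrable D (EFin \o f).
Proof.
move=> mD cf f0 intf; apply/integrableP; split.
  apply/measurable_EFinP; apply: measurable_funTS.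
  exact: continuous_measurable_fun.
have -> : (fun x => `|(EFin \o f) x|%E) = EFin \o f.
  by apply/funext => x /=; rewrite ger0_norm.
by rewrite intf ltry.

Qed.

Lemma integrable_expR_sinh_y (R : realType) (c r : R) : 0 < c ->
  lebesgue_measure.-integrable `[r, +oo[
    (EFin \o (fun x => c * cosh x * expR (- c * sinh x))).
Proof.
move=> c0; apply: integrable_ge0_continuous (integral_expR_sinh_y r c0) => //.
  exact: continuous_deriv_expR_sinh.
by move=> x; exact: deriv_expR_sinh_ge0.
Qed.

Lemma integrable_expR_sinh_Ny (R : realType) (c l : R) : 0 < c ->
  lebesgue_measure.-integrable `]-oo, l]
    (EFin \o (fun x => c * cosh x * expR (c * sinh x))).
Proof.
move=> c0; apply: integrable_ge0_continuous (integral_expR_sinh_Ny l c0) => //.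
  exact: continuous_deriv_expR_sinh.
by move=> x; exact: deriv_expR_sinh_ge0.
Qed.

(** * Norms of entrywise integrals *)

Lemma Re_le_norm (R : realType) (z : R[i]) : `|complex.Re z| <= complex.Re `|z|.
Proof.
by rewrite normc_def /= -sqrtr_sqr ler_wsqrtr // lerDl sqr_ge0.
Qed.

Lemma Im_le_norm (R : realType) (z : R[i]) : `|complex.Im z| <= complex.Re `|z|.
Proof.
by rewrite normc_def /= -sqrtr_sqr ler_wsqrtr // lerDr sqr_ge0.
Qed.

Definition complex_integrable (R : realType) (D : set R) (f : R -> R[i]) :
    Prop :=
  lebesgue_measure.-integrable D (EFin \o (fun x => complex.Re (f x))) /\
  lebesgue_measure.-integrable D (EFin \o (fun x => complex.Im (f x))).

Lemma dominated_continuous_integrable (R : realType) (D : set R)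
    (f g : R -> R) : measurable D -> continuous f ->
  (forall x, D x -> `|f x| <= g x) ->
  lebesgue_measure.-integrable D (EFin \o g) ->
  lebesgue_measure.-integrable D (EFin \o f).
Proof.
move=> mD cf fg; apply: le_integrable => //.
  apply/measurable_EFinP; apply: measurable_funTS.
  exact: continuous_measurable_fun.
by move=> x Dx /=; rewrite lee_fin; apply: le_trans (fg x Dx) (ler_norm _).
Qed.

Section MatrixIntegral.
Variables (R : realType) (n : nat) (N : 'M[R[i]]_n -> R).
Hypothesis hN : consistent_norm N.

Lemma norm_dominated_entry_integrable (D : set R) (G : R -> 'M[R[i]]_n)
    (g : R -> R) (i j : 'I_n) : measurable D ->
  complex_continuous (fun x => G x i j) ->
  lebesgue_measure.-integrable D (EFin \o g) ->
  (forall x, D x -> N (G x) <= g x) ->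
  complex_integrable D (fun x => G x i j).
Proof.
move=> mD [cRe cIm] intg Gg.
have [C C0 entryC] := entry_le_consistent_norm hN i j.
have intCg := integrable_RZl (mu := lebesgue_measure) C mD intg.
split; apply: dominated_continuous_integrable intCg => // x Dx.
  apply: le_trans (Re_le_norm _) _; apply: le_trans (entryC _) _.
  by rewrite ler_wpM2l // Gg.
apply: le_trans (Im_le_norm _) _; apply: le_trans (entryC _) _.
by rewrite ler_wpM2l // Gg.
Qed.

(** A complex matrix is encoded as the real block row of its real and imaginary
parts, on which [N] becomes a sublinear functional over the reals. *)
Lemma norm_mxintegral_le (D : set R) (G : R -> 'M[R[i]]_n) (g : R -> R) :
  measurable D -> (forall i j, complex_integrable D (fun x => G x i j)) ->
  lebesgue_measure.-integrable D (EFin \o g) ->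
  (forall x, D x -> N (G x) <= g x) ->
  N (mxintegral D G) <= \int[lebesgue_measure]_(x in D) g x.
Proof.
move=> mD intG intg Gg.
pose cmx (Z : 'M[R]_(n, n + n)) : 'M[R[i]]_n :=
  \matrix_(i, j) (Z i (lshift n j) +i* Z i (rshift n j)).
pose rmx (X : 'M[R[i]]_n) : 'M[R]_(n, n + n) :=
  row_mx (map_mx (@complex.Re R) X) (map_mx (@complex.Im R) X).
have cmxK X : cmx (rmx X) = X.
  apply/matrixP => i j; rewrite mxE row_mxEl row_mxEr !mxE.
  by case: (X i j).
have sp : sublinear (fun Z => N (cmx Z)).
  split=> [X Y|c X c0].
    rewrite (_ : cmx (X + Y) = cmx X + cmx Y); first exact: consistent_normD.
    by apply/matrixP => i j; rewrite !mxE.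
  rewrite (_ : cmx (c *: X) = c%:C *: cmx X).
    by rewrite (consistent_normZ_real hN) ger0_norm.
  by apply/matrixP => i j; rewrite !mxE; simpc.
have intr i j :
    lebesgue_measure.-integrable D (EFin \o (fun x => rmx (G x) i j)).
  rewrite -[j]splitK; case: (fintype.split j) => k /=.
    by under [X in _ \o X]eq_fun do rewrite row_mxEl mxE; exact: (intG i k).1.
  by under [X in _ \o X]eq_fun do rewrite row_mxEr mxE; exact: (intG i k).2.
have := sublinear_integral_le (mu := lebesgue_measure) sp mD intr intg.
rewrite (_ : cmx _ = mxintegral D G).
  by apply=> x Dx; rewrite cmxK Gg.
apply/matrixP => i j; rewrite !mxE.
under eq_Rintegral do rewrite row_mxEl mxE.
by under [in X in _ +i* X]eq_Rintegral do rewrite row_mxEr mxE.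
Qed.

End MatrixIntegral.

(** The pieces are added as extended reals, where additivity only asks for
measurability; they are finite because [f] is integrable on each of them. *)
Lemma Rintegral_sub_segment (R : realType) (l r : R) (f : R -> R) : l <= r ->
  continuous f ->
  lebesgue_measure.-integrable `]-oo, l] (EFin \o f) ->
  lebesgue_measure.-integrable `[r, +oo[ (EFin \o f) ->
  (\int[lebesgue_measure]_x f x - \int[lebesgue_measure]_(x in `[l, r]) f x =
   \int[lebesgue_measure]_(x in `]-oo, l]) f x +
   \int[lebesgue_measure]_(x in `[r, +oo[) f x)%R.
Proof.
move=> lr cf intl intr.
have intm : lebesgue_measure.-integrable `[l, r] (EFin \o f).
  apply: continuous_compact_integrable; first exact: segment_compact.
  exact: continuous_subspaceT.
have mf (D : set R) : measurable D -> measurable_fun D (EFin \o f).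
  move=> mD; apply/measurable_EFinP; apply: measurable_funTS.
  exact: continuous_measurable_fun.
have TE : (\int[lebesgue_measure]_x (f x)%:E =
    \int[lebesgue_measure]_(x in `]-oo, l]) (f x)%:E +
    (\int[lebesgue_measure]_(x in `[l, r]) (f x)%:E +
     \int[lebesgue_measure]_(x in `[r, +oo[) (f x)%:E))%E.
  rewrite -(itv_setU_setT false l) integral_setU //; first last.
  - exact: disjoint_rays.
  - by apply: mf; exact: measurableU.
  congr (_ + _)%E.
  rewrite (@itv_bndbnd_setU _ _ (BRight l) (BRight r)) ?bnd_simp //.
  rewrite integral_setU //; first last.
  - apply/disj_setPS => x [] /=; rewrite !in_itv /= andbT => /andP[_ xr].
    by rewrite ltNge xr.
  - by apply: mf; exact: measurableU.
  by rewrite !integral_itv_obnd_cbnd //; exact: mf.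
have fin (D : set R) : measurable D ->
    lebesgue_measure.-integrable D (EFin \o f) ->
    (\int[lebesgue_measure]_(x in D) (f x)%:E)%E \is a fin_num.
  move=> mD intD.
  exact: (integrable_fin_num (mu := lebesgue_measure) mD intD).
rewrite /Rintegral TE.
have finl := fin _ (measurable_itv _) intl.
have finm := fin _ (measurable_itv _) intm.
have finr := fin _ (measurable_itv _) intr.
have finmr : (\int[lebesgue_measure]_(x in `[l, r]) (f x)%:E +
    \int[lebesgue_measure]_(x in `[r, +oo[) (f x)%:E)%E \is a fin_num.
  by rewrite fin_numD; apply/andP.
rewrite (fineD finl finmr) (fineD finm finr).
lra.
Qed.

Lemma Rintegral_lincomb d (T : measurableType d) (R : realType)
    (mu : {measure set T -> \bar R}) (D : set T) (a b : R) (f g : T -> R) :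
  measurable D ->
  mu.-integrable D (EFin \o f) -> mu.-integrable D (EFin \o g) ->
  mu.-integrable D (EFin \o (fun x => a * f x + b * g x)) /\
  (\int[mu]_(x in D) (a * f x + b * g x) =
   a * \int[mu]_(x in D) f x + b * \int[mu]_(x in D) g x)%R.
Proof.
move=> mD intf intg.
have intaf := integrable_RZl a mD intf; have intbg := integrable_RZl b mD intg.
split; first exact: (integrableD mD intaf intbg).
by rewrite RintegralD // !RintegralZl.
Qed.

(** * The double exponential integrand and its tails *)

Section Quadrature.
Variables (R : realType) (n : nat) (A : 'M[R[i]]_n) (alpha : R).
Variable N : 'M[R[i]]_n -> R.
Hypothesis hA : forall x : R, x <= 0 -> ~~ eigenvalue A x%:C.
Hypothesis alpha_gt0 : 0 < alpha.
Hypothesis alpha_lt1 : alpha < 1.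
Hypothesis hN : consistent_norm N.

Definition de_rate : R := alpha * pi / 2.
Local Notation k := de_rate.

Definition sinc_alpha_pi : R := sin (alpha * pi) / (alpha * pi).
Local Notation sg := sinc_alpha_pi.

(** [t(x)^(1/alpha)], see [powR_t_DE]: the shift at which the resolvent is
evaluated. *)
Definition root_t_DE (x : R) : R := expR (pi / 2 * sinh x).
Local Notation s := root_t_DE.

Lemma alpha_pi_gt0 : 0 < alpha * pi.
Proof. by rewrite mulr_gt0 ?pi_gt0. Qed.

Lemma sinc_ge0 : 0 <= sg.
Proof.
rewrite divr_ge0 ?(ltW alpha_pi_gt0) // ltW // sin_gt0_pi // alpha_pi_gt0 /=.
by rewrite gtr_pMl ?pi_gt0.
Qed.

Lemma t_DE_E : t_DE alpha = fun x => expR (k * sinh x).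
Proof. by apply/funext => x; rewrite /t_DE /k mulrAC. Qed.

Lemma powR_t_DE x : t_DE alpha x `^ (1 / alpha) = s x.
Proof.
rewrite t_DE_E -expRM /s /k; congr expR.
by field; exact: lt0r_neq0.
Qed.

Lemma F_DE_E x : F_DE A alpha x =
  (k * cosh x * expR (k * sinh x) * sg)%:C *: (A *m invmx ((s x)%:C%:M + A)).
Proof.
rewrite /F_DE /F scalerA -rmorphM powR_t_DE t_DE_E; congr ((_ * _)%:C *: _).
by rewrite derive1E; have ? := is_derive_expR_sinh k x; exact: derive_val.
Qed.

Lemma shift_s_unitmx x : (s x)%:C%:M + A \in unitmx.
Proof. by apply: shift_unitmx => //; exact: expR_ge0. Qed.

Lemma complex_continuous_F_DE i j :
  complex_continuous (fun x => F_DE A alpha x i j).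
Proof.
rewrite (_ : (fun x => _) = fun x => (k * cosh x * expR (k * sinh x) * sg)%:C *
    (A *m invmx ((s x)%:C%:M + A)) i j); last first.
  by apply/funext => x; rewrite F_DE_E mxE.
apply: complex_continuousM.
  apply: complex_continuous_real => x; apply: cvgMr_tmp.
  exact: continuous_deriv_expR_sinh.
apply: complex_continuous_shift_inv shift_s_unitmx _ _.
exact: continuous_expR_sinh.
Qed.

Lemma norm_F_DE x : N (F_DE A alpha x) =
  k * cosh x * expR (k * sinh x) * sg * N (A *m invmx ((s x)%:C%:M + A)).
Proof.
rewrite F_DE_E (consistent_normZ_real hN) ger0_norm // mulr_ge0 ?sinc_ge0 //.
by rewrite deriv_expR_sinh_ge0 // /k divr_gt0 // alpha_pi_gt0.
Qed.

Lemma sinh_homo : {homo @sinh R : x y / x <= y}.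
Proof.
by move=> x y xy; rewrite ler_pM2r ?invr_gt0 // lerB ?ler_expR // lerN2.
Qed.

Lemma root_t_DE_homo : {homo s : x y / x <= y}.
Proof.
by move=> x y /sinh_homo; rewrite ler_expR ler_pM2l // divr_gt0 ?pi_gt0.
Qed.

(** [sg t'(x)] times the bound of [norm_mul_shift_inv_small], arranged as a
combination of derivatives of [exp(c sinh x)]: since
[s(x) = exp((pi/2) sinh x)], the product [k cosh(x) exp(k sinh x) s(x)] is
[k/(k + pi/2)] times the derivative for [c = k + pi/2], and
[k/(k + pi/2) = alpha/(1 + alpha)]. *)
Definition left_majorant x := sg * N 1%:M * (k * cosh x * expR (k * sinh x)) +
  sg * (2 * N (invmx A)) * (alpha / (1 + alpha)) *
  ((k + pi / 2) * cosh x * expR ((k + pi / 2) * sinh x)).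

Lemma norm_F_DE_left l x : 2 * s l * N (invmx A) <= 1 -> x <= l ->
  N (F_DE A alpha x) <= left_majorant x.
Proof.
move=> sl xl; have N0 := consistent_norm_ge0 hN.
have sx : 2 * s x * N (invmx A) <= 1.
  apply: le_trans sl; rewrite ler_wpM2r // ler_pM2l //; exact: root_t_DE_homo.
have := norm_mul_shift_inv_small hN hA (expR_ge0 _) sx.
rewrite norm_F_DE => le_resolvent.
apply: le_trans (ler_wpM2l _ le_resolvent) _.
  rewrite mulr_ge0 ?sinc_ge0 // deriv_expR_sinh_ge0 // /k divr_gt0 //.
  exact: alpha_pi_gt0.
rewrite /left_majorant (mulrDl k _ (sinh x)) expRD -/(s x) /k le_eqVlt.
apply/orP; left; apply/eqP; field.
by rewrite gt_eqF // addr_gt0.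
Qed.

(** Same rearrangement for the bound of [norm_mul_shift_inv_large], where the
powers [s^-1] and [s^-2] turn the exponent [k] into [-(pi/2 - k)] and
[-(pi - k)]. *)
Definition right_majorant x := sg * N A * (alpha / (1 - alpha)) *
    ((pi / 2 - k) * cosh x * expR (- (pi / 2 - k) * sinh x)) +
  sg * (2 * N A ^+ 2) * (alpha / (2 - alpha)) *
    ((pi - k) * cosh x * expR (- (pi - k) * sinh x)).

Lemma norm_F_DE_right r x : 2 * N A <= s r -> r <= x ->
  N (F_DE A alpha x) <= right_majorant x.
Proof.
move=> sr rx; have N0 := consistent_norm_ge0 hN.
have sx : 2 * N A <= s x by apply: le_trans sr _; exact: root_t_DE_homo.
have := norm_mul_shift_inv_large hN hA (expR_gt0 _) sx.
rewrite norm_F_DE => le_resolvent.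
apply: le_trans (ler_wpM2l _ le_resolvent) _.
  rewrite mulr_ge0 ?sinc_ge0 // deriv_expR_sinh_ge0 // /k divr_gt0 //.
  exact: alpha_pi_gt0.
rewrite /right_majorant.
have -> : - (pi / 2 - k) * sinh x = k * sinh x - pi / 2 * sinh x by ring.
have -> : - (pi - k) * sinh x = k * sinh x - pi / 2 * sinh x - pi / 2 * sinh x.
  by field.
rewrite !expRD !expRN -/(s x) le_eqVlt; apply/orP; left.
have s0 : s x != 0 by rewrite gt_eqF ?expR_gt0.
rewrite /k; apply/eqP; field.
by rewrite s0 /= !lt0r_neq0 // subr_gt0 // (lt_trans alpha_lt1) // ltr1n.
Qed.

Lemma de_rate_gt0 : 0 < k.
Proof. by rewrite divr_gt0 ?alpha_pi_gt0. Qed.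

Lemma de_rate_lt : k < pi / 2.
Proof. by rewrite ltr_pM2r ?invr_gt0 // gtr_pMl ?pi_gt0. Qed.

Lemma left_majorant_integral l :
  lebesgue_measure.-integrable `]-oo, l] (EFin \o left_majorant) /\
  (\int[lebesgue_measure]_(x in `]-oo, l]) left_majorant x =
   sg * N 1%:M * expR (k * sinh l) +
   sg * (2 * N (invmx A)) * (alpha / (1 + alpha)) *
     expR ((k + pi / 2) * sinh l))%R.
Proof.
have kp : 0 < k + pi / 2 by rewrite addr_gt0 ?de_rate_gt0 // divr_gt0 ?pi_gt0.
have -> : expR (k * sinh l) = (\int[lebesgue_measure]_(x in `]-oo, l])
    (k * cosh x * expR (k * sinh x)))%R.
  by rewrite /Rintegral integral_expR_sinh_Ny ?de_rate_gt0.
have -> : expR ((k + pi / 2) * sinh l) =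
    (\int[lebesgue_measure]_(x in `]-oo, l])
    ((k + pi / 2) * cosh x * expR ((k + pi / 2) * sinh x)))%R.
  by rewrite /Rintegral integral_expR_sinh_Ny.
apply: Rintegral_lincomb => //.
  exact: integrable_expR_sinh_Ny de_rate_gt0.
exact: integrable_expR_sinh_Ny.
Qed.

Lemma right_majorant_integral r :
  lebesgue_measure.-integrable `[r, +oo[ (EFin \o right_majorant) /\
  (\int[lebesgue_measure]_(x in `[r, +oo[) right_majorant x =
   sg * N A * (alpha / (1 - alpha)) * expR (- (pi / 2 - k) * sinh r) +
   sg * (2 * N A ^+ 2) * (alpha / (2 - alpha)) * expR (- (pi - k) * sinh r))%R.
Proof.
have kp1 : 0 < pi / 2 - k by rewrite subr_gt0 de_rate_lt.
have kp2 : 0 < pi - k by have := de_rate_lt; have := pi_gt0 R; lra.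
rewrite -[expR (- (pi / 2 - k) * _)](congr1 fine (integral_expR_sinh_y r kp1)).
rewrite -[expR (- (pi - k) * _)](congr1 fine (integral_expR_sinh_y r kp2)).
by apply: Rintegral_lincomb => //; exact: integrable_expR_sinh_y.
Qed.

Lemma root_t_DE_left l : t_DE alpha l <= (2 * N (invmx A)) `^ (- alpha) ->
  2 * s l * N (invmx A) <= 1.
Proof.
move=> al; have N0 : 0 <= 2 * N (invmx A).
  by rewrite mulr_ge0 // consistent_norm_ge0.
rewrite mulrAC; have [->|NA] := eqVneq (2 * N (invmx A)) 0.
  by rewrite mul0r.
have NA0 : 0 < 2 * N (invmx A) by rewrite lt_neqAle eq_sym NA.
rewrite -ler_pdivlMl // mulr1 -(powR_inv1 N0) -powR_t_DE.
have -> : -1 = - alpha * (1 / alpha) by field; exact: lt0r_neq0.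
rewrite (powRrM (2 * N (invmx A))).
apply: (ge0_ler_powR _ _ _ al); rewrite ?nnegrE ?powR_ge0 ?expR_ge0 //.
by rewrite divr_ge0 // ltW.
Qed.

Lemma root_t_DE_right r : (2 * N A) `^ alpha <= t_DE alpha r -> 2 * N A <= s r.
Proof.
move=> br; have N0 : 0 <= 2 * N A by rewrite mulr_ge0 // consistent_norm_ge0.
have -> : 2 * N A = ((2 * N A) `^ alpha) `^ (1 / alpha).
  by rewrite -powRrM mul1r mulfV ?gt_eqF // powRr1.
rewrite -powR_t_DE.
apply: (ge0_ler_powR _ _ _ br); rewrite ?nnegrE ?powR_ge0 ?expR_ge0 //.
by rewrite divr_ge0 // ltW.
Qed.

(** The quantity [2 s(l) N(A^-1)], at most 1 by the hypothesis, absorbs the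
extra factor [s(l)] left by the second term of the majorant. *)
Lemma left_tail l : t_DE alpha l <= (2 * N (invmx A)) `^ (- alpha) ->
  (forall i j, complex_integrable `]-oo, l] (fun x => F_DE A alpha x i j)) /\
  N (mxintegral `]-oo, l] (F_DE A alpha)) <=
    sin (alpha * pi) * (alpha + (1 + alpha) * N 1%:M) /
      (alpha * pi * (1 + alpha)) * t_DE alpha l.
Proof.
move=> /root_t_DE_left sl; have [intg intgE] := left_majorant_integral l.
have leg x : `]-oo, l]%classic x -> N (F_DE A alpha x) <= left_majorant x.
  by rewrite /= in_itv /=; exact: norm_F_DE_left.
have intF i j : complex_integrable `]-oo, l] (fun x => F_DE A alpha x i j).
  apply: (norm_dominated_entry_integrable hN) intg leg => //.
  exact: complex_continuous_F_DE.
split=> //; apply: le_trans (norm_mxintegral_le hN _ intF intg leg) _ => //.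
rewrite intgE (mulrDl k _ (sinh l)) expRD -/(s l) t_DE_E.
have a0 := expR_gt0 (k * sinh l); move: (expR (k * sinh l)) a0 => a a0.
rewrite [leLHS](_ : _ = sg * a *
  (N 1%:M + alpha / (1 + alpha) * (2 * s l * N (invmx A)))); last by ring.
rewrite [leRHS](_ : _ = sg * a * (N 1%:M + alpha / (1 + alpha))); last first.
  rewrite /sg; move: (pi : R) (pi_gt0 R) => p p0; field.
  by rewrite (gt_eqF p0) (gt_eqF alpha_gt0) gt_eqF // addr_gt0.
rewrite ler_wpM2l ?(mulr_ge0 sinc_ge0) ?(ltW a0) // lerD2l.
by rewrite ler_piMr // divr_ge0 ?(ltW alpha_gt0) // addr_ge0 // ltW.
Qed.

(** Symmetrically, [2 N(A) / s(r) <= 1] absorbs one power of [N(A) / s(r)] in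
the second term of the majorant. *)
Lemma right_tail r : (2 * N A) `^ alpha <= t_DE alpha r ->
  (forall i j, complex_integrable `[r, +oo[ (fun x => F_DE A alpha x i j)) /\
  N (mxintegral `[r, +oo[ (F_DE A alpha)) <=
    sin (alpha * pi) * (3 - 2 * alpha) * N A /
      (pi * (1 - alpha) * (2 - alpha)) * t_DE alpha r `^ (1 - 1 / alpha).
Proof.
move=> /root_t_DE_right sr; have [intg intgE] := right_majorant_integral r.
have leg x : `[r, +oo[%classic x -> N (F_DE A alpha x) <= right_majorant x.
  by rewrite /= in_itv /= andbT; exact: norm_F_DE_right.
have intF i j : complex_integrable `[r, +oo[ (fun x => F_DE A alpha x i j).
  apply: (norm_dominated_entry_integrable hN) intg leg => //.
  exact: complex_continuous_F_DE.
split=> //; apply: le_trans (norm_mxintegral_le hN _ intF intg leg) _ => //.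
have bE : t_DE alpha r `^ (1 - 1 / alpha) = expR (- (pi / 2 - k) * sinh r).
  rewrite t_DE_E -expRM /k; congr expR.
  by field; exact: lt0r_neq0.
rewrite intgE bE.
have -> : - (pi - k) * sinh r = - (pi / 2 - k) * sinh r - pi / 2 * sinh r.
  by field.
rewrite expRD expRN -/(s r).
have b0 := expR_gt0 (- (pi / 2 - k) * sinh r).
move: (expR (- (pi / 2 - k) * sinh r)) b0 => b b0.
have s0 : 0 < s r := expR_gt0 _.
have NA0 := consistent_norm_ge0 hN A.
rewrite [leLHS](_ : _ = sg * alpha * N A * b *
  (1 / (1 - alpha) + 1 / (2 - alpha) * (2 * N A / s r))); last by ring.
have a1 : 0 < 1 - alpha by rewrite subr_gt0.
have a2 : 0 < 2 - alpha by lra.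
rewrite [leRHS](_ : _ = sg * alpha * N A * b *
  (1 / (1 - alpha) + 1 / (2 - alpha))); last first.
  rewrite /sg; move: (pi : R) (pi_gt0 R) => p p0; field.
  by rewrite (gt_eqF p0) (gt_eqF alpha_gt0) (gt_eqF a1) (gt_eqF a2).
rewrite ler_wpM2l //.
  by rewrite (mulr_ge0 _ (ltW b0)) // mulr_ge0 // (mulr_ge0 sinc_ge0) // ltW.
rewrite lerD2l ler_piMr // ?divr_ge0 ?(ltW a2) //.
by rewrite ler_pdivrMr // mul1r.
Qed.

End Quadrature.

(** * The truncation error *)

Unset Implicit Arguments.

Theorem lemma3p1 (R : realType) (n : nat) (A : 'M[R[i]]_n) (alpha : R)
    (N : 'M[R[i]]_n -> R) (l r : R)
    (hA : forall x : R, x <= 0 -> ~~ eigenvalue A x%:C)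
    (halpha0 : 0 < alpha) (halpha1 : alpha < 1)
    (hN : consistent_norm N)
    (hlr : l <= r) :
  let a := expR (alpha * pi * sinh l / 2) in
  let b := expR (alpha * pi * sinh r / 2) in
  a <= (2 * N (invmx A)) `^ (- alpha) ->
  (2 * N A) `^ alpha <= b ->
  N (mxintegral setT (F_DE A alpha) - mxintegral `[l, r] (F_DE A alpha)) <=
    sin (alpha * pi) * (alpha + (1 + alpha) * N 1%:M) /
      (alpha * pi * (1 + alpha)) * a +
    sin (alpha * pi) * (3 - 2 * alpha) * N A /
      (pi * (1 - alpha) * (2 - alpha)) * b `^ (1 - 1 / alpha).
Proof.
move=> a b al br.
have [intl lel] := left_tail hA halpha0 halpha1 hN al.
have [intr ler] := right_tail hA halpha0 halpha1 hN br.
have -> : mxintegral setT (F_DE A alpha) - mxintegral `[l, r] (F_DE A alpha) =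
    mxintegral `]-oo, l] (F_DE A alpha) + mxintegral `[r, +oo[ (F_DE A alpha).
  apply/matrixP => i j; rewrite !mxE.
  have [cRe cIm] := complex_continuous_F_DE hA halpha0 i j.
  have [lRe lIm] := intl i j; have [rRe rIm] := intr i j.
  apply/eqP; rewrite eq_complex /=; apply/andP; split; apply/eqP.
    exact: (Rintegral_sub_segment hlr cRe lRe rRe).
  exact: (Rintegral_sub_segment hlr cIm lIm rIm).
exact: le_trans (consistent_normD hN _ _) (lerD lel ler).
Qed.
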